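(* Let $\alpha\in[0,1)$, let $\hat q\in\Delta\mathcal{K}$, $\bar q\in\mathbb{R}_+^{\mathcal{K}}$, $\Gamma\ge 0$, and let $$\mathcal{Q}:=\Big\{q\in\mathbb{R}^{\mathcal{K}}\;:\;\exists z\in\mathcal{Z}(\Gamma),\ q\ge 0,\ \sum_{k\in\mathcal{K}}q_k=1,\ q=\hat q+\mathrm{diag}(\bar q)z\Big\},\qquad \mathcal{Z}(\Gamma)=\Big\{z\in\mathbb{R}^{\mathcal{K}}\;:\;-1\le z_k\le 1\ \forall k,\ \sum_{k\in\mathcal{K}}|z_k|\le\Gamma\Big\}.$$ Consider the semi-infinite problem $$(\mathrm{P})\quad\begin{aligned} \min_{u,\zeta,\Delta,t,\eta}\quad & t\\ \text{subject to}\quad & \zeta+\frac{1}{1-\alpha}\sum_{\ell\in\mathcal{L}}\sum_{k\in\mathcal{K}}q_k\Delta_{\ell,k}\le t\quad\forall q\in\mathcal{Q},\\ & (u,\zeta,\Delta,\eta)\in\mathcal{F}, \end{aligned}$$ where $\mathcal{F}$ is the set of all $(u,\zeta,\Delta,\eta)\in\mathbb{R}^{\mathcal{L}}\times\mathbb{R}\times\mathbb{R}^{\mathcal{L}\times\mathcal{K}}\times\mathbb{R}^{\mathcal{L}}$ such that $$\Delta_{\ell,k}\ge u_\ell f_{\ell,k}-\eta_\ell,\quad \eta_\ell=u_\ell\zeta,\quad \Delta_{\ell,k}\ge 0\quad(\forall\ell\in\mathcal{L},k\in\mathcal{K}),\qquad u\ge 0,\quad \sum_{\ell\in\mathcal{L}}u_\ell=1,\quad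 0\le\zeta\le\bar\zeta,$$ with $\bar\zeta:=\max_{k\in\mathcal{K}}f_{0,k}$. Then the robust counterpart of $(\mathrm{P})$ is the finite problem $$(\mathrm{RC})\quad\begin{aligned} \min_{u,t,w,w^-,\eta,\chi,\beta,\Delta,\zeta}\quad & t\\ \text{subject to}\quad & \zeta+\sum_{k'\in\mathcal{K}}w_{k'}+\sum_{k'\in\mathcal{K}}w^-_{k'}+\Gamma\chi+\sum_{k'\in\mathcal{K}}\hat q_{k'}\beta_{k'}+\frac{1}{1-\alpha}\sum_{\ell\in\mathcal{L}}\Delta_{\ell,k}-\beta_k\le t &&\forall k\in\mathcal{K},\\ &\chi\ge \bar q_k\beta_k-w_k &&\forall k\in\mathcal{K},\\ &\chi\ge -\bar q_k\beta_k-w^-_k &&\forall k\in\mathcal{K},\\ & w\ge 0,\ w^-\ge 0,\ \chi\ge 0,\\ & (u,\zeta,\Delta,\eta)\in\mathcal{F}, \end{aligned}$$ with $w,w^-,\beta\in\mathbb{R}^{\mathcal{K}}$ and $\chi\in\mathbb{R}$. That is, $(u,\zeta,\Delta,t,\eta)$ is feasible for $(\mathrm{P})$ if and only if there exist $w,w^-,\chi,\beta$ such that $(u,t,w,w^-,\eta,\chi,\beta,\Delta,\zeta)$ is feasible for $(\mathrm{RC})$; in particular the two problems have the same optimal value.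
   Context: Let $G=(V,E)$ be a finite directed graph with distinct source $s$ and sink $t$ in $V$ (the node $t$ is unrelated to the scalar variable $t$ in the optimization problems). Let $\mathcal{K}$ be a finite nonempty set of scenarios, and for each $k\in\mathcal{K}$ let $c^k\in\mathbb{R}_+^{E}$ be a vector of arc capacities. For an integer $B\ge 0$, the set of interdiction plans is $\mathcal{L}=\{\ell\in\{0,1\}^{E}:\sum_{e\in E}\ell_e\le B\}$; $0\in\mathcal{L}$ denotes the plan with no interdiction. For $\ell\in\mathcal{L}$ and $k\in\mathcal{K}$, $f_{\ell,k}$ is the maximum flow into $t$ after interdiction: $$f_{\ell,k}:=\max\Big\{\sum_{e\text{ entering }t}x_e \;:\; \sum_{e\text{ leaving }i}x_e-\sum_{e\text{ entering }i}x_e=0\ \ \forall i\in V\setminus\{s,t\},\ \ 0\le x_e\le c^k_e(1-\ell_e)\ \ \forall e\in E\Big\}.$$ $\Delta\mathcal{K}\subseteq\mathbb{R}_+^{\mathcal{K}}$ denotes the set of probability distributions on $\mathcal{K}$ (not to be confused with the decision variable $\Delta\in\mathbb{R}^{\mathcal{L}\times\mathcal{K}}$). Problem $(\mathrm{P})$ is the epigraph form of the problem of choosing a distribution $u$ over interdiction plans that minimizes the worst-case (over $q\in\mathcal{Q}$) conditional value at risk at level $\alpha$ of the flow $f_{\ell,k}$ under $\ell\sim u$, $k\sim q$. *)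

(* Defs.v *)
From HB Require Import structures.
From mathcomp Require Import all_boot all_order all_algebra.
From mathcomp Require Import all_classical all_reals all_analysis.
Import Order.TTheory GRing.Theory Num.Theory numFieldNormedType.Exports.

Set Implicit Arguments.
Unset Strict Implicit.
Unset Printing Implicit Defensive.

Local Open Scope classical_set_scope.
Local Open Scope ring_scope.

(* Vectors of R^I, for I a finite index type, are functions I -> R. *)

(* A directed graph is given by a type V of nodes, a type E of arcs and the
   maps tail, head : E -> V; the arc e leaves tail e and enters head e. *)

Definition is_flow (R : realType) (V E : finType) (tail head : E -> V)
    (src snk : V) (cap : E -> R) (x : E -> R) : Prop :=
  (forall i : V, i != src -> i != snk ->
     \sum_(e | tail e == i) x e - \sum_(e | head e == i) x e = 0) /\
  (forall e : E, 0 <= x e <= cap e).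

Definition inflow (R : realType) (V E : finType) (head : E -> V) (snk : V)
    (x : E -> R) : R :=
  \sum_(e | head e == snk) x e.

(* The supremum is a maximum by max_flow_attained. *)
Definition max_flow (R : realType) (V E : finType) (tail head : E -> V)
    (src snk : V) (cap : E -> R) : R :=
  sup [set inflow head snk x | x in is_flow tail head src snk cap].

Definition interdicted_flow (R : realType) (V E K : finType)
    (tail head : E -> V) (src snk : V) (c : K -> E -> R)
    (l : {ffun E -> bool}) (k : K) : R :=
  max_flow tail head src snk (fun e => c k e * (1 - (l e)%:R)).

Record plan (E : finType) (B : nat) := Plan {
  plan_val :> {ffun E -> bool};
  _ : (\sum_(e : E) plan_val e <= B)%N }.
HB.instance Definition _ E B := [isSub for @plan_val E B].
HB.instance Definition _ E B := [Finite of plan E B by <:].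

(* The supremum is a maximum by zeta_bar_attained. *)
Definition zeta_bar (R : realType) (E K : finType)
    (f : {ffun E -> bool} -> K -> R) : R :=
  sup [set f [ffun=> false] k | k in [set: K]].

Definition distributions (R : realType) (K : finType) : set (K -> R) :=
  [set q | (forall k, 0 <= q k) /\ \sum_(k : K) q k = 1].

Definition budget_set (R : realType) (K : finType) (Gam : R) : set (K -> R) :=
  [set z | (forall k, -1 <= z k <= 1) /\ \sum_(k : K) `|z k| <= Gam].

Definition ambiguity_set (R : realType) (K : finType) (qhat qbar : K -> R)
    (Gam : R) : set (K -> R) :=
  [set q | exists z, [/\ budget_set Gam z, forall k, 0 <= q k,
     \sum_(k : K) q k = 1 & forall k, q k = qhat k + qbar k * z k]].

Definition F_feasible (R : realType) (E K : finType) (B : nat)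
    (f : {ffun E -> bool} -> K -> R) (u : plan E B -> R) (zeta : R)
    (Delta : plan E B -> K -> R) (eta : plan E B -> R) : Prop :=
  [/\ forall l k, [/\ u l * f l k - eta l <= Delta l k,
        eta l = u l * zeta & 0 <= Delta l k],
      forall l, 0 <= u l,
      \sum_(l : plan E B) u l = 1 &
      0 <= zeta <= zeta_bar f].

Definition P_feasible (R : realType) (E K : finType) (B : nat)
    (f : {ffun E -> bool} -> K -> R) (alpha : R) (qhat qbar : K -> R) (Gam : R)
    (u : plan E B -> R) (zeta : R) (Delta : plan E B -> K -> R) (t : R)
    (eta : plan E B -> R) : Prop :=
  (forall q, ambiguity_set qhat qbar Gam q ->
     zeta + 1 / (1 - alpha) *
       \sum_(l : plan E B) \sum_(k : K) q k * Delta l k <= t) /\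
  F_feasible f u zeta Delta eta.

Definition RC_feasible (R : realType) (E K : finType) (B : nat)
    (f : {ffun E -> bool} -> K -> R) (alpha : R) (qhat qbar : K -> R) (Gam : R)
    (u : plan E B -> R) (t : R) (w wm : K -> R) (eta : plan E B -> R) (chi : R)
    (beta : K -> R) (Delta : plan E B -> K -> R) (zeta : R) : Prop :=
  [/\ forall k : K,
        zeta + \sum_(k' : K) w k' + \sum_(k' : K) wm k' + Gam * chi
        + \sum_(k' : K) qhat k' * beta k'
        + 1 / (1 - alpha) * \sum_(l : plan E B) Delta l k - beta k <= t,
      forall k : K, qbar k * beta k - w k <= chi,
      forall k : K, - qbar k * beta k - wm k <= chi,
      [/\ forall k, 0 <= w k, forall k, 0 <= wm k & 0 <= chi] &
      F_feasible f u zeta Delta eta].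

(* Optimal values are infima in the extended reals of the attainable
   objective values. *)
Definition P_value (R : realType) (E K : finType) (B : nat)
    (f : {ffun E -> bool} -> K -> R) (alpha : R) (qhat qbar : K -> R)
    (Gam : R) : \bar R :=
  ereal_inf [set t%:E | t in [set t : R |
    exists (u : plan E B -> R) zeta Delta eta,
      P_feasible f alpha qhat qbar Gam u zeta Delta t eta]].

Definition RC_value (R : realType) (E K : finType) (B : nat)
    (f : {ffun E -> bool} -> K -> R) (alpha : R) (qhat qbar : K -> R)
    (Gam : R) : \bar R :=
  ereal_inf [set t%:E | t in [set t : R |
    exists (u : plan E B -> R) w wm eta chi beta Delta zeta,
      RC_feasible f alpha qhat qbar Gam u t w wm eta chi beta Delta zeta]].

Lemma max_flow_attained (R : realType) (V E : finType) (tail head : E -> V)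
    (src snk : V) (cap : E -> R) : (forall e, 0 <= cap e) ->
  exists2 x, is_flow tail head src snk cap x &
    inflow head snk x = max_flow tail head src snk cap /\
    forall y, is_flow tail head src snk cap y ->
      inflow head snk y <= inflow head snk x.
Proof.
move=> cap_ge0.
pose T := prod_topology (fun _ : E => R).
have projC (e : E) : continuous (fun x : T => x e : R).
  exact: (@proj_continuous _ (fun _ : E => R) e).
have sumC (P : pred E) : continuous (fun x : T => \sum_(e | P e) x e : R).
  apply: continuous_big => [|e _]; [exact: (@add_continuous R^o) | exact: projC].
have subC (P Q : pred E) :
    continuous (fun x : T => \sum_(e | P e) x e - \sum_(e | Q e) x e : R).
  move=> x; exact: (@cvgB _ R^o _ _ _ _ _ _ _ (sumC P x) (sumC Q x)).
pose A : set T := is_flow tail head src snk cap.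
have A0 : A !=set0.
  exists (fun=> 0); split=> [i _ _|e]; first by rewrite !big1 // subr0.
  by rewrite lexx cap_ge0.
have cA : compact A.
  have cB := @tychonoff E (fun _ => R) (fun e => `[0, cap e]%classic)
    (fun e => @segment_compact R 0 (cap e)).
  apply: (subclosed_compact _ cB); last first.
    by move=> x [_ hx] e /=; rewrite in_itv /=.
  have -> : A = (\bigcap_(i in [set i | i != src /\ i != snk])
      [set x : T | \sum_(e | tail e == i) x e - \sum_(e | head e == i) x e = 0])
    `&` [set x : T | forall e, `[0, cap e]%classic (x e)].
    apply/seteqP; split=> x /= [h1 h2].
      by split=> [i [] /h1 h /h //|e]; rewrite /= in_itv /=.
    by split=> [i ? ?|e]; [exact: h1 | move: (h2 e); rewrite /= in_itv].
  apply: closedI.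
    apply: closed_bigI => i _.
    by apply: (@preimage_closed T R _ [set 0]).
  by apply: compact_closed cB; apply: hausdorff_product => ?; exact: Rhausdorff.
have [x Ax xmax] := compact_EVT_max A0 cA
  (continuous_subspaceT (sumC (fun e => head e == snk))).
have xge y : A y -> inflow head snk y <= inflow head snk x.
  by move=> Ay; apply: xmax; rewrite inE.
exists x; first by rewrite inE in Ax.
split=> //; apply/eqP; rewrite eq_le; apply/andP; split.
  apply: ub_le_sup; last by exists x => //; rewrite inE in Ax.
  by exists (inflow head snk x) => _ [y Ay <-]; exact: xge.
apply: ge_sup; first by case: A0 => y Ay; exists (inflow head snk y), y.
by move=> _ [y Ay <-]; exact: xge.
Qed.

Lemma zeta_bar_attained (R : realType) (E K : finType)
    (f : {ffun E -> bool} -> K -> R) : (0 < #|K|)%N ->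
  exists2 k, zeta_bar f = f [ffun=> false] k &
    forall k', f [ffun=> false] k' <= f [ffun=> false] k.
Proof.
case/card_gt0P=> k0 _; pose g := f [ffun=> false].
have [k _ kmax] := @arg_maxP _ R K k0 xpredT g isT.
exists k => [|k']; last exact: kmax.
apply/eqP; rewrite eq_le; apply/andP; split.
  by apply: ge_sup; [exists (g k0), k0|move=> _ [k' _ <-]; exact: kmax].
apply: ub_le_sup; last by exists k.
by exists (g k) => _ [k' _ <-]; exact: kmax.
Qed.

(* Main.v *)
(** Write d_k = (1 - alpha)^-1 sum_l Delta_{l,k}.  The semi-infinite constraint of
    (P) says that q |-> q . d is at most t - zeta on the polytope Q.  The constraints of (RC) on
    (w, w^-, chi, beta) form a finite linear system; by Farkas' lemma, if it has no solution
    there are multipliers (q, p, m) with total mass S = sum_k q_k such that q / S lies in Q,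
    with deviation z = (p - m) / S, and q . d > S (t - zeta).  Farkas' lemma itself is
    obtained by Fourier-Motzkin elimination. *)

Require Import Defs.
From mathcomp Require Import all_boot all_order all_algebra.
From mathcomp Require Import all_classical all_reals all_analysis.
From mathcomp Require Import ring lra.
Import Order.TTheory GRing.Theory Num.Theory numFieldNormedType.Exports.

Local Open Scope classical_set_scope.
Local Open Scope ring_scope.

(** * Farkas' lemma by Fourier-Motzkin elimination *)

(** Rows with [a n < 0] bound [v] below by [g n / a n], rows with [0 < a p] bound it above by
    [g p / a p]. The second hypothesis puts every lower bound below every upper bound, so the
    largest lower bound works; failing any, the smallest upper bound, or else 0. *)
Lemma one_variable_system (R : realFieldType) (J : finType) (a g : J -> R) :
  (forall j, a j = 0 -> 0 <= g j) ->
  (forall p n, 0 < a p -> a n < 0 -> 0 <= a p * g n - a n * g p) ->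
  exists v, forall j, v * a j <= g j.
Proof.
move=> g0 gPN.
have [[n0 an0]|noN] := pselect (exists n, a n < 0).
  have [n an nmax] :=
    @arg_maxP _ R J n0 (fun n => a n < 0) (fun n => g n / a n) an0.
  exists (g n / a n) => j; have [aj|aj|/eqP aj] := ltrgt0P (a j).
  - by rewrite mulrAC ler_ndivrMr //; have := gPN j n aj an; lra.
  - by rewrite -ler_ndivrMr //; exact: nmax.
  - by move/eqP: aj => aj; rewrite aj mulr0; exact: g0.
have aN j : 0 <= a j by rewrite leNgt; apply/negP => aj; apply: noN; exists j.
have [[p0 ap0]|noP] := pselect (exists p, 0 < a p).
  have [p ap pmin] :=
    @arg_minP _ R J p0 (fun p => 0 < a p) (fun p => g p / a p) ap0.
  exists (g p / a p) => j; have := aN j; rewrite le_eqVlt => /orP[/eqP aj|aj].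
    by rewrite -aj mulr0; exact: g0.
  by rewrite -ler_pdivlMr //; exact: pmin.
exists 0 => j; rewrite mul0r; apply: g0; apply/eqP; rewrite eq_le aN andbT.
by rewrite leNgt; apply/negP => aj; apply: noP; exists j.
Qed.

Lemma sum_deltal (R : pzRingType) (I : finType) (h : I -> R) (i : I) :
  \sum_j (j == i)%:R * h j = h i.
Proof.
rewrite (bigD1 i) //= eqxx mul1r big1 ?addr0 // => j /negPf ->.
by rewrite mul0r.
Qed.

(** The list [s] holds the variables still allowed to occur, so that eliminating one shortens [s]
    while the index type [I] stays fixed. *)
Lemma farkas_support (R : realFieldType) (I : finType) (s : seq I) (J : finType)
    (A : J -> I -> R) (b : J -> R) :
  (forall j i, i \notin s -> A j i = 0) ->
  (exists x : I -> R, forall j, \sum_i A j i * x i <= b j) \/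
  (exists y : J -> R, [/\ forall j, 0 <= y j,
     forall i, \sum_j y j * A j i = 0 & \sum_j y j * b j < 0]).
Proof.
elim: s J A b => [|i s IHs] J A b As.
  have [b0|/existsNP[j /negP]] := pselect (forall j, 0 <= b j).
    by left; exists (fun=> 0) => j; rewrite big1 // => i _; rewrite mulr0.
  rewrite -ltNge => bj; right; exists (fun j' => (j' == j)%:R); split=> [j'|i|].
  - exact: ler0n.
  - by rewrite big1 // => j' _; rewrite As ?mulr0.
  - by rewrite sum_deltal.
(* Row [e] of the eliminated system: row [e.1] itself if it is free of [i], the nonnegative
   combination cancelling [i] for opposite signs, and a zero row otherwise, so that all of [J * J]
   can index the rows. *)
pose C (e : J * J) (j : J) : R :=
  if A e.1 i == 0 then (j == e.1)%:R
  else if (0 < A e.1 i) && (A e.2 i < 0) then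
    A e.1 i * (j == e.2)%:R - A e.2 i * (j == e.1)%:R
  else 0.
have CE e h : \sum_j C e j * h j =
    if A e.1 i == 0 then h e.1
    else if (0 < A e.1 i) && (A e.2 i < 0) then
      A e.1 i * h e.2 - A e.2 i * h e.1 else 0.
  rewrite /C; case: ifP => _; first exact: sum_deltal.
  case: ifP => _; last by rewrite big1 // => j _; rewrite mul0r.
  under eq_bigr do rewrite mulrBl -!mulrA.
  by rewrite sumrB -!mulr_sumr !sum_deltal.
have C_ge0 e j : 0 <= C e j.
  rewrite /C; case: ifP => _; first exact: ler0n.
  case: ifP => // /andP[ap an]; rewrite subr_ge0.
  apply: (@le_trans _ _ 0); first by rewrite mulr_le0_ge0 ?ler0n // ltW.
  by rewrite mulr_ge0 ?ler0n // ltW.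
have [e i'|[x hx]|[y [y0 yA yb]]] := IHs (J * J)%type
  (fun e i' => \sum_j C e j * A j i') (fun e => \sum_j C e j * b j).
- move=> i's; have [->|ne] := eqVneq i' i.
    rewrite CE; case: ifP => [/eqP //|_]; case: ifP => // _; ring.
  by rewrite big1 // => j _; rewrite As ?mulr0 // inE negb_or ne.
(* [g] is the slack of [x] in the original rows, possibly negative; shifting coordinate [i] by a
   suitable [v] repairs it. *)
- left; pose g j := b j - \sum_i' A j i' * x i'.
  have Cg e : 0 <= \sum_j C e j * g j.
    rewrite (eq_bigr (fun j => C e j * b j - C e j * \sum_i' A j i' * x i'));
      last by move=> j _; rewrite mulrBr.
    rewrite sumrB subr_ge0; apply: le_trans (hx e).
    under [leRHS]eq_bigr do rewrite mulr_suml.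
    rewrite exchange_big /=; apply: ler_sum => j _; rewrite mulr_sumr.
    by apply: ler_sum => i' _; rewrite mulrA.
  have [j aj|p n ap an|v hv] := @one_variable_system R J (A^~ i) g.
  + by have := Cg (j, j); rewrite CE /= aj eqxx.
  + by have := Cg (p, n); rewrite CE /= ap an (gt_eqF ap).
  exists (fun i' => x i' + v * (i' == i)%:R) => j.
  under eq_bigr do rewrite mulrDr.
  rewrite big_split /= [X in _ + X](bigD1 i) //= eqxx mulr1.
  rewrite [X in _ + (_ + X)]big1 => [|i' /negPf ->]; last by rewrite !mulr0.
  by rewrite addr0 -lerBrDl [A j i * v]mulrC; exact: hv.
(* A certificate for the combined rows pulls back through [C] to the original rows. *)
have push h : \sum_j (\sum_e y e * C e j) * h j =
    \sum_e y e * \sum_j C e j * h j.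
  under eq_bigr do rewrite mulr_suml.
  rewrite exchange_big; apply: eq_bigr => e _; rewrite mulr_sumr.
  by apply: eq_bigr => j _; rewrite mulrA.
right; exists (fun j => \sum_e y e * C e j); split=> [j|i'|].
- by apply: sumr_ge0 => e _; rewrite mulr_ge0.
- by rewrite push yA.
- by rewrite push.
Qed.

Lemma farkas (R : realFieldType) (I J : finType) (A : J -> I -> R) (b : J -> R) :
  (exists x : I -> R, forall j, \sum_i A j i * x i <= b j) \/
  (exists y : J -> R, [/\ forall j, 0 <= y j,
     forall i, \sum_j y j * A j i = 0 & \sum_j y j * b j < 0]).
Proof. by apply: (@farkas_support R I (enum I)) => j i; rewrite mem_enum. Qed.

(** * Linear duality over the ambiguity set *)

(** Weak duality: average the first family of constraints with weights [q], substitute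
    [qhat + qbar * z] for [q] in the [beta] term, and absorb the deviation using the budget. *)
Lemma ambiguity_dual_bound (R : realType) (K : finType) (qhat qbar d : K -> R)
    (Gam T : R) (w wm beta : K -> R) (chi : R) (q : K -> R) :
  (forall k, \sum_k' w k' + \sum_k' wm k' + Gam * chi
     + \sum_k' qhat k' * beta k' + d k - beta k <= T) ->
  (forall k, qbar k * beta k - w k <= chi) ->
  (forall k, - qbar k * beta k - wm k <= chi) ->
  (forall k, 0 <= w k) -> (forall k, 0 <= wm k) -> 0 <= chi ->
  ambiguity_set qhat qbar Gam q -> \sum_k q k * d k <= T.
Proof.
move=> main hw hwm w0 wm0 chi0 [z [[z1 zG] q0 q1 qE]].
(* For [z k >= 0] scale the [w] constraint by [z k <= 1]; for [z k < 0] scale the [wm] constraint by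
   [- z k <= 1]. *)
have bz k : qbar k * beta k * z k <= w k + wm k + chi * `|z k|.
  have /andP[zl zu] := z1 k; have := hw k; have := hwm k.
  have := w0 k; have := wm0 k; case: (ger0P (z k)) => zk; nra.
set c := \sum_k' w k' + \sum_k' wm k' + Gam * chi + \sum_k' qhat k' * beta k'.
have qd : \sum_k q k * d k <= \sum_k q k * (T - c + beta k).
  by apply: ler_sum => k _; apply: ler_wpM2l => //; have := main k; rewrite -/c; lra.
apply: le_trans qd _; under eq_bigr do rewrite mulrDr.
rewrite big_split /= -mulr_suml q1 mul1r -lerBrDl opprB addrC subrK.
rewrite (eq_bigr (fun k => qhat k * beta k + qbar k * beta k * z k)); last first.
  by move=> k _; rewrite qE; ring.
rewrite big_split /= addrC lerD2r.
apply: le_trans (ler_sum _ (fun k _ => bz k)) _.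
rewrite !big_split /= lerD2l -mulr_sumr mulrC.
exact: ler_wpM2r.
Qed.

Lemma ambiguity_dual_attained (R : realType) (K : finType)
    (qhat qbar d : K -> R) (Gam T : R) :
  0 <= Gam ->
  (forall q, ambiguity_set qhat qbar Gam q -> \sum_k q k * d k <= T) ->
  exists (w wm : K -> R) (chi : R) (beta : K -> R),
  [/\ forall k, \sum_k' w k' + \sum_k' wm k' + Gam * chi
        + \sum_k' qhat k' * beta k' + d k - beta k <= T,
      forall k, qbar k * beta k - w k <= chi,
      forall k, - qbar k * beta k - wm k <= chi &
      [/\ forall k, 0 <= w k, forall k, 0 <= wm k & 0 <= chi]].
Proof.
move=> Gam0 hQ.
have sumDr (h : K -> R) k : \sum_j h j * (k == j)%:R = h k.
  by rewrite -[RHS]sum_deltal; apply: eq_bigr => j _; rewrite mulrC eq_sym.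
have sum0l (h : K -> R) : \sum_j 0 * h j = 0.
  by rewrite big1 // => j _; rewrite mul0r.
have sum0r (h : K -> R) : \sum_j h j * 0 = 0.
  by rewrite big1 // => j _; rewrite mulr0.
(* The explicit factors [1 *] and [-1 *] in the matrix [A] below give its entries the shape matched
   by [sumM] and [sumMr]. *)
have sumM (h : K -> R) a k : \sum_j a * (j == k)%:R * h j = a * h k.
  by under eq_bigr do rewrite -mulrA; rewrite -mulr_sumr sum_deltal.
have sumMr (h g : K -> R) k : \sum_j h j * (g j * (k == j)%:R) = h k * g k.
  by rewrite -(sumDr (fun j => h j * g j)); under eq_bigr do rewrite mulrA.
(* Columns: w, w^-, beta, chi.  Rows: the epigraph constraints, the two families
   bounding chi below, then w >= 0, w^- >= 0, chi >= 0. *)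
pose A (j : K + (K + (K + (K + (K + 'I_1))))) (i : K + (K + (K + 'I_1))) : R :=
  match j, i with
  | inl k, inl _ => 1
  | inl k, inr (inl _) => 1
  | inl k, inr (inr (inl k')) => qhat k' - 1 * (k' == k)%:R
  | inl k, inr (inr (inr _)) => Gam
  | inr (inl k), inl k' => -1 * (k' == k)%:R
  | inr (inl k), inr (inl _) => 0
  | inr (inl k), inr (inr (inl k')) => qbar k * (k' == k)%:R
  | inr (inl k), inr (inr (inr _)) => -1
  | inr (inr (inl k)), inl _ => 0
  | inr (inr (inl k)), inr (inl k') => -1 * (k' == k)%:R
  | inr (inr (inl k)), inr (inr (inl k')) => - qbar k * (k' == k)%:R
  | inr (inr (inl k)), inr (inr (inr _)) => -1
  | inr (inr (inr (inl k))), inl k' => -1 * (k' == k)%:R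
  | inr (inr (inr (inr (inl k)))), inr (inl k') => -1 * (k' == k)%:R
  | inr (inr (inr (inr (inr _)))), inr (inr (inr _)) => -1
  | _, _ => 0
  end.
pose b (j : K + (K + (K + (K + (K + 'I_1))))) : R :=
  if j is inl k then T - d k else 0.
have [[x hx]|[y [y0 yA yb]]] := @farkas R _ _ A b.
  exists (fun k => x (inl k)), (fun k => x (inr (inl k))),
    (x (inr (inr (inr ord0)))), (fun k => x (inr (inr (inl k)))).
  split=> [k|k|k|]; last split=> [k|k|].
  - have := hx (inl k); rewrite !big_sumType !big_ord1 /=.
    under [X in X + (_ + (_ + _)) <= _]eq_bigr do rewrite mul1r.
    under [X in _ + (X + (_ + _)) <= _]eq_bigr do rewrite mul1r.
    under [X in _ + (_ + (X + _)) <= _]eq_bigr do rewrite mulrBl.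
    by rewrite sumrB sumM; lra.
  - have := hx (inr (inl k)); rewrite !big_sumType !big_ord1 /=.
    by rewrite !sumM sum0l; lra.
  - have := hx (inr (inr (inl k))); rewrite !big_sumType !big_ord1 /=.
    by rewrite !sumM sum0l; lra.
  - have := hx (inr (inr (inr (inl k)))); rewrite !big_sumType !big_ord1 /=.
    by rewrite !sumM !sum0l; lra.
  - have := hx (inr (inr (inr (inr (inl k))))).
    by rewrite !big_sumType !big_ord1 /= !sumM !sum0l; lra.
  - have := hx (inr (inr (inr (inr (inr ord0))))).
    by rewrite !big_sumType !big_ord1 /= !sum0l; lra.
exfalso.
(* The multipliers of the sign constraints act as slacks: the columns of [w], [wm] and [chi] give
   the inequalities [p_le], [m_le] and [pm_le], while the free variable [beta] gives the equality
   [qE]. *)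
pose q k := y (inl k); pose p k := y (inr (inl k)).
pose m k := y (inr (inr (inl k))); pose S := \sum_k q k.
have q_ge0 k : 0 <= q k by exact: y0.
have p_le k : p k <= S.
  have := yA (inl k); rewrite !big_sumType !big_ord1 /= !sumMr !sum0r -mulr_suml.
  by have := y0 (inr (inr (inr (inl k)))); rewrite /S /q /p; lra.
have m_le k : m k <= S.
  have := yA (inr (inl k)); rewrite !big_sumType !big_ord1 /= !sumMr !sum0r -mulr_suml.
  by have := y0 (inr (inr (inr (inr (inl k))))); rewrite /S /q /m; lra.
have pm_le : \sum_k p k + \sum_k m k <= Gam * S.
  have := yA (inr (inr (inr ord0))).
  rewrite !big_sumType !big_ord1 /= !sum0r -!mulr_suml.
  by have := y0 (inr (inr (inr (inr (inr ord0))))); rewrite /S /q /p /m; lra.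
have qE k : q k = S * qhat k + qbar k * (p k - m k).
  have := yA (inr (inr (inl k))); rewrite !big_sumType !big_ord1 /= !sumMr !sum0r.
  under [X in X + _]eq_bigr do rewrite mulrBr mul1r.
  by rewrite sumrB sumDr -mulr_suml /S /q /p /m; lra.
have qT : \sum_k q k * (T - d k) < 0.
  by move: yb; rewrite !big_sumType !big_ord1 /= !sum0r; rewrite /q; lra.
have S_ge0 : 0 <= S by exact: sumr_ge0.
have p_ge0 k : 0 <= p k by exact: y0.
have m_ge0 k : 0 <= m k by exact: y0.
(* If [S = 0] then [q] vanishes, against the strict [qT]; so dividing by [S] is legitimate. *)
move: S_ge0; rewrite le_eqVlt => /orP[/eqP S0|S_gt0].
  move: qT; rewrite big1 ?ltxx // => k _.
  by rewrite (psumr_eq0P (fun k _ => q_ge0 k) (esym S0)) ?mul0r.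
have /hQ : ambiguity_set qhat qbar Gam (fun k => q k / S).
  exists (fun k => (p k - m k) / S); split=> [|k||k].
  - split=> [k|].
      rewrite ler_pdivlMr // ler_pdivrMr //.
      by have := p_le k; have := m_le k; have := p_ge0 k; have := m_ge0 k; lra.
    under eq_bigr do rewrite normrM (gtr0_norm (_ : 0 < S^-1)) ?invr_gt0 //.
    rewrite -mulr_suml ler_pdivrMr //; apply: le_trans pm_le.
    rewrite -big_split; apply: ler_sum => k _; apply: le_trans (ler_normB _ _) _.
    by rewrite !ger0_norm.
  - by rewrite divr_ge0 // ltW.
  - by rewrite -mulr_suml divff ?gt_eqF.
  - by rewrite qE; field; rewrite gt_eqF.
under eq_bigr do rewrite mulrAC.
rewrite -mulr_suml ler_pdivrMr // => dT.
move: qT; under eq_bigr do rewrite mulrBr.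
by rewrite sumrB -mulr_suml -/S; lra.
Qed.

Theorem proposition2 (R : realType) (V E K : finType) (tail head : E -> V)
    (src snk : V) (c : K -> E -> R) (B : nat)
    (alpha Gam : R) (qhat qbar : K -> R) :
  src != snk ->
  (0 < #|K|)%N ->
  (forall k e, 0 <= c k e) ->
  0 <= alpha < 1 ->
  distributions qhat ->
  (forall k, 0 <= qbar k) ->
  0 <= Gam ->
  let f := interdicted_flow tail head src snk c in
  (forall (u : plan E B -> R) (zeta : R) (Delta : plan E B -> K -> R) (t : R)
      (eta : plan E B -> R),
     P_feasible f alpha qhat qbar Gam u zeta Delta t eta <->
     exists (w wm : K -> R) (chi : R) (beta : K -> R),
       RC_feasible f alpha qhat qbar Gam u t w wm eta chi beta Delta zeta) /\
  P_value B f alpha qhat qbar Gam = RC_value B f alpha qhat qbar Gam.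
Proof.
move=> _ _ _ _ _ _ Gam0 f.
have feas (u : plan E B -> R) zeta Delta t eta :
    P_feasible f alpha qhat qbar Gam u zeta Delta t eta <->
    exists (w wm : K -> R) (chi : R) (beta : K -> R),
      RC_feasible f alpha qhat qbar Gam u t w wm eta chi beta Delta zeta.
  pose d k := 1 / (1 - alpha) * \sum_(l : plan E B) Delta l k.
  have dE (q : K -> R) : 1 / (1 - alpha) *
      \sum_(l : plan E B) \sum_k q k * Delta l k = \sum_k q k * d k.
    rewrite exchange_big mulr_sumr; apply: eq_bigr => k _.
    by rewrite -mulr_sumr mulrCA.
  split=> [[hq hF]|[w [wm [chi [beta [main hw hwm [w0 wm0 chi0] hF]]]]]].
    (* Both problems share [F_feasible], so only the bound [t - zeta] on the linear form given by
       [d] has to be dualized. *)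
    have [q /hq|w [wm [chi [beta [main hw hwm h0]]]]] :=
      @ambiguity_dual_attained R K qhat qbar d Gam (t - zeta) Gam0.
      by rewrite dE; lra.
    exists w, wm, chi, beta; split=> // k.
    by have := main k; rewrite /d; lra.
  split=> // q hq; rewrite dE -lerBrDl.
  apply: ambiguity_dual_bound hw hwm w0 wm0 chi0 hq => k.
  by have := main k; rewrite /d; lra.
(* By [feas], both infima range over the same set of [t]. *)
split=> //; rewrite /P_value /RC_value; congr ereal_inf; congr image.
apply/seteqP; split=> t /=.
  move=> [u [zeta [Delta [eta /feas[w [wm [chi [beta h]]]]]]]].
  by exists u, w, wm, eta, chi, beta, Delta, zeta.
move=> [u [w [wm [eta [chi [beta [Delta [zeta h]]]]]]]].
by exists u, zeta, Delta, eta; apply/feas; exists w, wm, chi, beta.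
Qed.
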